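(* Let $X$ be any Banach space which is not superreflexive. Then there is a constant $C<\infty$ (depending only on $X$) such that for every integer $n\ge 2$ there exist a map $f_n:\mathcal{G}_n\to X$ and a number $s_n>0$ with $$s_n\,\rho_n(u,v)\le \|f_n(u)-f_n(v)\|_X\le C\,s_n\,\rho_n(u,v)\quad\text{for all }u,v\in\mathcal{G}_n .$$ In other words, the Cayley graphs of $\mathbb{Z}_2\wr\mathbb{Z}_n$ ($n\ge2$) with respect to the generating set $\{t,ta\}$ admit bilipschitz embeddings into $X$ with uniformly bounded distortions.
   Context: For $n\ge 2$, the lamplighter group $\mathcal{G}_n=\mathbb{Z}_2\wr\mathbb{Z}_n$ is the set of pairs $(x,k)$ where $x\subseteq\mathbb{Z}_n$ (the set of positions where the lamp is on) and $k\in\mathbb{Z}_n$ (the position of the lamplighter), with multiplication $(x,k)\cdot(y,l)=(x\,\triangle\,(k+y),\,k+l)$, where $\triangle$ is symmetric difference and $k+y=\{k+j:j\in y\}$. Put $t=(\emptyset,1)$ and $a=(\{0\},0)$, so $ta=(\{1\},1)$. Thus right multiplication by $t$ sends $(x,k)$ to $(x,k+1)$, and right multiplication by $ta$ sends $(x,k)$ to $(x\triangle\{k+1\},k+1)$. The Cayley graph of $\mathcal{G}_n$ with respect to $S=\{t,ta\}$ has vertex set $\mathcal{G}_n$, with $u,v$ adjacent iff $u=vs$ or $v=us$ for some $s\in S$; $\rho_n$ denotes its shortest-path metric. *)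

(* Defs.v *)
From Stdlib Require Import Reals.
From HB Require Import structures.
From mathcomp Require Import all_boot all_algebra.

Set Implicit Arguments. Unset Strict Implicit. Unset Printing Implicit Defensive.

(* Lamplighter group  Z_2 wr Z_n  (intended for n >= 2, where 'Z_n = Z/nZ) *)

Definition LL (n : nat) : finType := ({set 'Z_n} * 'Z_n)%type.

Definition symd (n : nat) (A B : {set 'Z_n}) : {set 'Z_n} := (A :\: B) :|: (B :\: A).

Definition LLmul (n : nat) (u v : LL n) : LL n :=
  (symd u.1 [set (u.2 + j)%R | j in v.1], (u.2 + v.2)%R).

Definition gen_t (n : nat) : LL n := (set0, 1%R).
Definition gen_a (n : nat) : LL n := ([set 0%R], 0%R).
Definition gen_ta (n : nat) : LL n := LLmul (gen_t n) (gen_a n).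

Definition cay_adj (n : nat) : rel (LL n) := fun u v =>
  [|| u == LLmul v (gen_t n), v == LLmul u (gen_t n),
      u == LLmul v (gen_ta n) | v == LLmul u (gen_ta n)].

Definition cay_dist (n : nat) (u v : LL n) (d : nat) : Prop :=
  (exists p : seq (LL n), [/\ path (@cay_adj n) u p, last u p = v & size p = d]) /\
  (forall p : seq (LL n), path (@cay_adj n) u p -> last u p = v -> (d <= size p)%N).

Record BanachSpace := {
  carrier :> Type;
  vzero : carrier;
  vadd : carrier -> carrier -> carrier;
  vopp : carrier -> carrier;
  vscal : R -> carrier -> carrier;
  vnorm : carrier -> R;
  vadd_assoc : forall x y z, vadd x (vadd y z) = vadd (vadd x y) z;
  vadd_comm : forall x y, vadd x y = vadd y x;
  vadd_0 : forall x, vadd x vzero = x;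
  vadd_opp : forall x, vadd x (vopp x) = vzero;
  vscal_1 : forall x, vscal R1 x = x;
  vscal_assoc : forall a b x, vscal a (vscal b x) = vscal (Rmult a b) x;
  vscal_distr_v : forall a x y, vscal a (vadd x y) = vadd (vscal a x) (vscal a y);
  vscal_distr_s : forall a b x, vscal (Rplus a b) x = vadd (vscal a x) (vscal b x);
  vnorm_def : forall x, vnorm x = R0 -> x = vzero;
  vnorm_scal : forall a x, vnorm (vscal a x) = Rmult (Rabs a) (vnorm x);
  vnorm_triangle : forall x y, Rle (vnorm (vadd x y)) (Rplus (vnorm x) (vnorm y));
  vcomplete : forall s : nat -> carrier,
    (forall eps, Rlt R0 eps -> exists N, forall i j, (N <= i)%coq_nat -> (N <= j)%coq_nat ->
        Rlt (vnorm (vadd (s i) (vopp (s j)))) eps) ->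
    exists l, forall eps, Rlt R0 eps -> exists N, forall i, (N <= i)%coq_nat ->
        Rlt (vnorm (vadd (s i) (vopp l))) eps
}.

Definition vdist (X : BanachSpace) (x y : X) : R := vnorm (vadd x (vopp y)).

Definition is_blf (X : BanachSpace) (phi : X -> R) : Prop :=
  (forall x y, phi (vadd x y) = Rplus (phi x) (phi y)) /\
  (forall a x, phi (vscal a x) = Rmult a (phi x)) /\
  (exists M, forall x, Rle (Rabs (phi x)) (Rmult M (vnorm x))).

Definition dual_bound (X : BanachSpace) (phi : X -> R) (c : R) : Prop :=
  Rle R0 c /\ forall x, Rle (Rabs (phi x)) (Rmult c (vnorm x)).

Definition is_bidual (X : BanachSpace) (Phi : (X -> R) -> R) : Prop :=
  (forall phi psi, is_blf phi -> is_blf psi ->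
     Phi (fun x => Rplus (phi x) (psi x)) = Rplus (Phi phi) (Phi psi)) /\
  (forall a phi, is_blf phi -> Phi (fun x => Rmult a (phi x)) = Rmult a (Phi phi)) /\
  (exists M, forall phi c, is_blf phi -> dual_bound phi c -> Rle (Rabs (Phi phi)) (Rmult M c)).

Definition reflexive (X : BanachSpace) : Prop :=
  forall Phi : (X -> R) -> R, is_bidual Phi ->
    exists x : X, forall phi, is_blf phi -> Phi phi = phi x.

Fixpoint lincomb (X : BanachSpace) (m : nat) (c : nat -> R) (v : nat -> X) : X :=
  match m with
  | 0 => vzero X
  | m'.+1 => vadd (lincomb m' c v) (vscal (c m') (v m'))
  end.

(* Y is finitely representable in X: for every finite-dimensional subspace
   F = span(y_0..y_{m-1}) of Y and eps > 0 there is a linear map T : F -> X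
   (determined by x_i = T y_i) with ||y|| <= ||T y|| <= (1+eps) ||y||. *)
Definition fin_representable (Y X : BanachSpace) : Prop :=
  forall (m : nat) (y : nat -> Y) (eps : R), Rlt R0 eps ->
    exists x : nat -> X, forall c : nat -> R,
      Rle (vnorm (lincomb m c y)) (vnorm (lincomb m c x)) /\
      Rle (vnorm (lincomb m c x)) (Rmult (Rplus R1 eps) (vnorm (lincomb m c y))).

Definition superreflexive (X : BanachSpace) : Prop :=
  forall Y : BanachSpace, fin_representable Y X -> reflexive Y.

(* Main.v *)
Require Import Defs.
From Stdlib Require Import Reals.
From HB Require Import structures.
From mathcomp Require Import all_boot all_algebra.
From mathcomp Require Import all_order boolp classical_sets functions reals Rstruct.
From mathcomp Require Import zify ring lra.

(** A non-superreflexive space [X] contains, by James, arbitrarily long finite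
    sequences that dominate the summing basis: [|x_i| <= K] and
    [|sum c_i x_i| >= delta * |sum_(i >= k) c_i|] for every [k].  So a sum of
    [x_i] with integer coefficients is long as soon as the coefficients over
    some interval of indices have a large sum.

    Since right multiplication by [t] and [t a] crosses the edge from [k] to
    [k+1] and sets lamp [k+1] freely, lamp [e] sits on the edge from [e-1] to
    [e], and the distance from [(x,k)] to [(y,l)] is the length of a shortest
    walk on the cycle from [k] to [l] that crosses all edges in the symmetric
    difference of [x] and [y].  It is at most [4 r + rho(k,l)], where [r] is the
    largest number of moves needed to cross one of these edges from [k].

    Cut the cycle at a point [c].  For each of the two directions, the lamps read
    from [c] up to the distance of [k] from [c] form a word, and one move of the
    lamplighter only appends or deletes a last letter: the group maps to a binary
    tree by a Lipschitz map.  As in Bourgain's embedding of trees, a word is sent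
    to the sum of the [x_i] over its prefixes, numbered so that the extensions of
    a given word form an interval.  With eight cuts, some cut is so placed that
    its trees detect a fixed proportion of [r], and some cut one of [rho(k,l)]. *)

Set Implicit Arguments. Unset Strict Implicit. Unset Printing Implicit Defensive.
Import Order.TTheory GRing.Theory Num.Theory.
Local Open Scope ring_scope.

(** * Hahn-Banach extension *)

Section LinearAlgebra.
Local Open Scope classical_set_scope.
Variables (R : realType) (V : lmodType R).
Implicit Types (u v : V) (W F : V -> Prop) (f g : V -> R).

Definition subspace W := W 0 /\ forall a u v, W u -> W v -> W (a *: u + v).

Definition linear_on W f :=
  forall a u v, W u -> W v -> f (a *: u + v) = a * f u + f v.

Lemma linear_on0 W f : subspace W -> linear_on W f -> f 0 = 0.
Proof.
move=> [W0 _] /(_ 1 0 0 W0 W0); rewrite scaler0 addr0 mul1r => E.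
by apply: (addIr (f 0)); rewrite add0r -E.
Qed.

Lemma subspaceZ W a u : subspace W -> W u -> W (a *: u).
Proof. by move=> [W0 Wl] Wu; rewrite -[_ *: _]addr0; apply: Wl. Qed.

Lemma linear_onZ W f a u : subspace W -> linear_on W f -> W u -> f (a *: u) = a * f u.
Proof.
by move=> sW lf Wu; rewrite -[_ *: _]addr0 lf ?(linear_on0 sW lf) ?addr0 //; case: sW.
Qed.

Section HahnBanach.
Variable B : V -> R -> Prop.
Hypothesis B0 : B 0 0.
Hypothesis BD : forall u v c d, B u c -> B v d -> B (u + v) (c + d).
Hypothesis BZ : forall a u c, B u c -> B (a *: u) (`|a| * c).

(** Graphs of partial linear functionals dominated by [B]; as sets of pairs they are ordered by
    inclusion, as Zorn's lemma wants. *)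
Let good (G : set (V * R)) :=
  (forall a u r v s, G (u, r) -> G (v, s) -> G (a *: u + v, a * r + s)) /\
  (forall v r c, G (v, r) -> B v c -> r <= c).

Let good_ext G x : good G -> G (0, 0) -> exists al,
  good [set p | exists v r t, G (v, r) /\ p = (v + t *: x, r + t * al)].
Proof.
move=> [Gl Gd] G0.
have GZ a v r : G (v, r) -> G (a *: v, a * r).
  by move=> Gv; have := Gl a _ _ _ _ Gv G0; rewrite !addr0.
have Gop v r : G (v, r) -> G (- v, - r).
  by move=> /(GZ (-1)); rewrite scaleN1r mulN1r.
have Bop v c : B v c -> B (- v) c.
  by move=> /(BZ (-1)); rewrite scaleN1r normrN1 mul1r.
(* By homogeneity the bound at [v + t *: x] need only be checked for [t = 1] and [t = -1]: upper and
   lower constraints on the value [al] at [x]. *)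
suff [al [up lo]] : exists al,
    (forall v r c, G (v, r) -> B (v + x) c -> al <= c - r) /\
    (forall v r c, G (v, r) -> B (v - x) c -> r - c <= al).
  exists al; split.
    move=> a _ _ _ _ [u [r [t [Gu [-> ->]]]]] [v [s [t' [Gv [-> ->]]]]].
    exists (a *: u + v), (a * r + s), (a * t + t'); split; first exact: Gl.
    congr pair; last by ring.
    by rewrite scalerDr scalerA scalerDl addrACA.
  move=> _ _ c [v [r [t [Gv [-> ->]]]]] Bc.
  have [t0|t0|t0] := ltgtP t 0; last first.
  - by move: Bc; rewrite t0 scale0r mul0r !addr0; apply: Gd.
  - have := up (t^-1 *: v) (t^-1 * r) (t^-1 * c) (GZ _ _ _ Gv).
    have := BZ t^-1 Bc; rewrite scalerDr scalerA mulVf ?gt_eqF // scale1r.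
    rewrite gtr0_norm ?invr_gt0 // => /[swap] /[apply].
    rewrite -mulrBr mulrC ler_pdivlMr //; lra.
  - have := lo ((- t)^-1 *: v) ((- t)^-1 * r) ((- t)^-1 * c) (GZ _ _ _ Gv).
    have := BZ (- t)^-1 Bc; rewrite scalerDr scalerA.
    have nt : 0 < - t by rewrite oppr_gt0.
    have -> : (- t)^-1 * t = -1 by rewrite invrN mulNr mulVf // lt_eqF.
    rewrite scaleN1r.
    rewrite gtr0_norm ?invr_gt0 // => /[swap] /[apply].
    rewrite -mulrBr mulrC ler_pdivrMr //; lra.
have key v r c v' r' c' : G (v, r) -> B (v + x) c -> G (v', r') -> B (v' - x) c' ->
    r' - c' <= c - r.
  move=> Gv Bv Gv' Bv'.
  have := BD Bv Bv'; rewrite addrACA subrr addr0.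
  have := Gl 1 _ _ _ _ Gv Gv'; rewrite scale1r mul1r => /Gd /[apply]; lra.
pose S : set R := [set z | exists v r c, [/\ G (v, r), B (v - x) c & z = r - c]].
(* The supremum of the lower constraints serves. If there are none, replacing [v] by [- v] shows
   that there are no upper ones either. *)
have [[z0 Sz0]|S0] := pselect (exists z, S z).
  have [v0 [r0 [c0 [Gv0 Bv0 _]]]] := Sz0.
  have hS : has_sup S.
    split; first by exists z0.
    exists (c0 - (- r0)) => z [v [r [c [Gv Bv ->]]]].
    by apply: (key (- v0)) Gv Bv; [exact: Gop|rewrite -[x]opprK -opprD; exact: Bop].
  exists (sup S); split=> v r c Gv Bv.
    apply: ge_sup; first by exists z0.
    by move=> z [v' [r' [c' [Gv' Bv' ->]]]]; apply: (key v r c v' r' c').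
  by apply: ub_le_sup; [case: hS|exists v, r, c].
exists 0; split=> v r c Gv Bv; case: S0.
  exists (- r - c), (- v), (- r), c; split=> //; first exact: Gop.
  by rewrite -opprD; exact: Bop.
by exists (r - c), v, r, c.
Qed.

(* The gauge [B v c] plays the role of [p v <= c] for a seminorm [p] that may
   take the value [+oo]; this spares both an infimum and the dual space as a type. *)
Theorem hahn_banach F f : subspace F -> linear_on F f ->
  (forall v c, F v -> B v c -> f v <= c) ->
  exists g, [/\ linear_on setT g, forall v, F v -> g v = f v &
                forall v c, B v c -> g v <= c].
Proof.
move=> sF lf fB; pose G0 : set (V * R) := [set p | F p.1 /\ p.2 = f p.1].
have goodG0 : good G0.
  split=> [a u r v s [/= Fu ->] [/= Fv ->]|v r c [/= Fv -> /fB]]; last exact.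
  by split=> /=; [apply: sF.2|rewrite lf].
(* Goodness is asked of the union with [G0], so that the empty chain is covered too. *)
have [|A [gA maxA]] := @Zorn_bigcup _ (fun A => good (A `|` G0)).
  move=> C Cg Ctot; have [[A0 CA0]|C0] := pselect (exists A, C A); last first.
    suff -> : \bigcup_(X in C) X = set0 by rewrite set0U.
    by apply/seteqP; split=> // y [X CX _]; case: C0; exists X.
  have sub X : C X -> X `|` G0 `<=` \bigcup_(X in C) X `|` G0.
    by move=> CX y [Xy|]; [left; exists X|right].
  have ex y z : (\bigcup_(X in C) X `|` G0) y -> (\bigcup_(X in C) X `|` G0) z ->
      exists X, [/\ C X, (X `|` G0) y & (X `|` G0) z].
    move=> [[X CX Xy]|Gy] [[Y CY Yz]|Gz].
    - have [XY|YX] := Ctot _ _ CX CY.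
        by exists Y; split=> //; left=> //; apply: XY.
      by exists X; split=> //; left=> //; apply: YX.
    - by exists X; split=> //; [left|right].
    - by exists Y; split=> //; [right|left].
    - by exists A0; split=> //; right.
  split=> [a u r v s Uu Uv|v r c Uv].
    have [X [CX Xu Xv]] := ex _ _ Uu Uv.
    by apply: (sub X) => //; apply: (Cg _ CX).1.
  by have [X [CX Xu _]] := ex _ _ Uv Uv; apply: (Cg _ CX).2.
pose G := A `|` G0; have G00 : G (0, 0).
  by right; split=> /=; [case: sF|rewrite (linear_on0 sF lf)].
have tot x : exists r, G (x, r).
  have [al gal] := good_ext x gA G00; set G' := [set p | _] in gal.
  have GG' : G `<=` G'.
    by move=> [v r] Gv; exists v, r, 0; rewrite scale0r mul0r !addr0.
  have G'x : G' (x, al) by exists 0, 0, 1; rewrite scale1r mul1r !add0r.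
  apply: contrapT => nx; apply: (maxA G').
    split=> [y Ay|/(_ _ G'x) Ax]; first by apply: GG'; left.
    by case: nx; exists al; left.
  suff -> : G' `|` G0 = G' by [].
  by apply/seteqP; split=> y; [case=> // G0y; apply: GG'; right|left].
have [Gl Gd] := gA; pose g v := projT1 (cid (tot v)).
have gG v : G (v, g v) by rewrite /g; case: cid.
(* Two values at [v] differ by a value at 0, which [B0] forces to be nonpositive. *)
have Guniq v r s : G (v, r) -> G (v, s) -> r = s.
  suff le r' s' : G (v, r') -> G (v, s') -> r' <= s'.
    by move=> Gr Gs; apply/eqP; rewrite eq_le !le.
  move=> Gr Gs; have := Gl (-1) _ _ _ _ Gs Gr; rewrite scaleN1r addNr => /Gd /(_ B0); lra.
exists g; split.
- by move=> a u v _ _; apply: (@Guniq (a *: u + v)); [exact: gG|apply: Gl; exact: gG].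
- by move=> v Fv; apply: (@Guniq v) => //; right.
- by move=> v c; apply: Gd (gG v).
Qed.

End HahnBanach.

(** Induction on [k]: a [z] in the first [k] kernels with [fs k z != 0] fixes the coefficient of
    [fs k]; without such a [z] the coefficient is 0. *)
Lemma vanish_on_kernels W k (fs : nat -> V -> R) g : subspace W ->
  (forall i, linear_on W (fs i)) -> linear_on W g ->
  (forall v, W v -> (forall i, (i < k)%N -> fs i v = 0) -> g v = 0) ->
  exists a : nat -> R, forall v, W v -> g v = \sum_(i < k) a i * fs i v.
Proof.
move=> sW lfs; elim: k g => [|k IH] g lg gv.
  by exists (fun=> 0) => v Wv; rewrite big_ord0; apply: gv.
have [[z [Wz zk fz]]|nz] := pselect (exists z,
    [/\ W z, forall i, (i < k)%N -> fs i z = 0 & fs k z != 0]).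
  pose t := g z / fs k z.
  have [||a aP] := IH (fun v => g v - t * fs k v).
  - by move=> a u v Wu Wv; rewrite lg // lfs //; ring.
  - move=> v Wv vk; pose b := - (fs k v / fs k z).
    have -> : g v - t * fs k v = g (b *: z + v) by rewrite lg // /b /t; field.
    apply: gv => [|i]; first exact: sW.2.
    rewrite ltnS leq_eqVlt lfs // => /orP[/eqP->|ik].
      by rewrite /b; field.
    by rewrite zk // vk //; ring.
  exists (fun i => if i == k then t else a i) => v Wv.
  rewrite big_ord_recr /= eqxx -[LHS](subrK (t * fs k v)) aP //; congr (_ + _).
  by apply: eq_bigr => i _; rewrite (ltn_eqF (ltn_ord i)).
have [|a aP] := IH g lg.
  move=> v Wv vk; apply: gv => // i; rewrite ltnS leq_eqVlt => /orP[/eqP->|/vk//].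
  by apply: contrapT => fv; apply: nz; exists v; split=> //; apply/eqP.
exists (fun i => if i == k then 0 else a i) => v Wv.
rewrite big_ord_recr /= eqxx mul0r addr0 aP //.
by apply: eq_bigr => i _; rewrite (ltn_eqF (ltn_ord i)).
Qed.

End LinearAlgebra.

Section HahnBanachPoint.
Variables (R : realType) (V : lmodType R) (B : V -> R -> Prop).
Hypothesis B0 : B 0 0.
Hypothesis BD : forall u v c d, B u c -> B v d -> B (u + v) (c + d).
Hypothesis BZ : forall a u c, B u c -> B (a *: u) (`|a| * c).
Hypothesis B_ge0 : forall u c, B u c -> 0 <= c.

Lemma hahn_banach_point x s : 0 < s -> (forall c, B x c -> s <= c) ->
  exists g, [/\ linear_on setT g, g x = s & forall v c, B v c -> g v <= c].
Proof.
move=> s0 sB; have x0 : x != 0 by apply/eqP => x0; have := sB 0; rewrite x0 leNgt s0 => /(_ B0).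
pose F v := exists t, v = t *: x.
(* The functional [t *: x] to [s * t] on the line through [x], with default value 0 elsewhere. *)
pose f v := if pselect (F v) is left e then s * projT1 (cid e) else 0.
have fE t : f (t *: x) = s * t.
  rewrite /f; case: pselect => [e|[]]; last by exists t.
  case: cid => t' /= /eqP; rewrite -subr_eq0 -scalerBl scaler_eq0 (negbTE x0) orbF.
  by rewrite subr_eq0 => /eqP->.
have [|||g [gl gf gB]] := @hahn_banach R V B B0 BD BZ F f.
- split; first by exists 0; rewrite scale0r.
  by move=> a _ _ [t ->] [t' ->]; exists (a * t + t'); rewrite scalerDl scalerA.
- move=> a _ _ [t ->] [t' ->].
  by rewrite scalerA -scalerDl !fE; ring.
- move=> _ c [t ->] Btx; rewrite fE.
  have [t0|t0] := leP t 0.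
    by apply: le_trans (B_ge0 Btx); rewrite pmulr_rle0.
  have := BZ t^-1 Btx; rewrite scalerA mulVf ?gt_eqF // scale1r => /sB.
  by rewrite gtr0_norm ?invr_gt0 // mulrC ler_pdivlMr.
exists g; split=> //; rewrite -[x]scale1r gf ?fE ?mulr1 //.
by exists 1.
Qed.

End HahnBanachPoint.

(** * Banach spaces as modules *)

Notation Rstd := Rdefinitions.R.
Arguments dual_bound {X} phi c%_ring_scope.

HB.instance Definition _ (X : BanachSpace) := gen_eqMixin (carrier X).
HB.instance Definition _ (X : BanachSpace) := gen_choiceMixin (carrier X).

Lemma vadd_0l (X : BanachSpace) : left_id (vzero X) (@vadd X).
Proof. by move=> x; rewrite vadd_comm vadd_0. Qed.

Lemma vadd_oppl (X : BanachSpace) : left_inverse (vzero X) (@vopp X) (@vadd X).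
Proof. by move=> x; rewrite vadd_comm vadd_opp. Qed.

HB.instance Definition _ (X : BanachSpace) := GRing.isZmodule.Build (carrier X)
  (@vadd_assoc X) (@vadd_comm X) (@vadd_0l X) (@vadd_oppl X).
HB.instance Definition _ (X : BanachSpace) :=
  GRing.Zmodule_isLmodule.Build Rstd (carrier X)
  (@vscal_assoc X) (@vscal_1 X) (@vscal_distr_v X) (fun v a b => @vscal_distr_s X a b v).

Section Norm.
Variable X : BanachSpace.
Implicit Types x y : X.

Lemma vnormZ (a : Rstd) x : vnorm (a *: x) = `|a| * vnorm x.
Proof. exact: etrans (vnorm_scal a x) (congr1 (Rmult^~ _) (RabsE a)). Qed.

Lemma vnormD x y : vnorm (x + y) <= vnorm x + vnorm y.
Proof. exact/RleP/vnorm_triangle. Qed.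

Lemma vnorm0 : vnorm (0 : X) = 0.
Proof. by rewrite -(scale0r (0 : X)) vnormZ normr0 mul0r. Qed.

Lemma vnormN x : vnorm (- x) = vnorm x.
Proof. by rewrite -scaleN1r vnormZ normrN1 mul1r. Qed.

Lemma vnorm_ge0 x : 0 <= vnorm x.
Proof. by have := vnormD x (- x); rewrite subrr vnorm0 vnormN; lra. Qed.

Lemma vnorm_sum I (r : seq I) (P : pred I) (F : I -> X) :
  vnorm (\sum_(i <- r | P i) F i) <= \sum_(i <- r | P i) vnorm (F i).
Proof.
elim/big_ind2: _ => [|x a y b xa yb|//]; first by rewrite vnorm0.
by apply: le_trans (vnormD _ _) _; apply: lerD.
Qed.

Lemma is_blfE (phi : X -> Rstd) : is_blf phi <->
  linear_on setT phi /\ exists M, forall x, `|phi x| <= M * vnorm x.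
Proof.
split=> [[phiD [phiZ [M HM]]]|[lphi [M HM]]].
  split; first by move=> a u v _ _; exact: etrans (phiD _ _) (congr1 (Rplus^~ _) (phiZ _ _)).
  by exists M => x; rewrite -RabsE; apply/RleP/HM.
split; first by move=> x y; have := lphi 1 x y I I; rewrite scale1r mul1r.
split; first by move=> a x; exact: (@linear_onZ _ _ setT).
by exists M => x; apply/RleP; rewrite RabsE; apply: HM.
Qed.

Lemma dual_boundE (phi : X -> Rstd) c : dual_bound phi c <->
  0 <= c /\ forall x, `|phi x| <= c * vnorm x.
Proof.
split=> -[/RleP c0 H]; split=> // x; first by rewrite -RabsE; apply/RleP/H.
by apply/RleP; rewrite RabsE; apply: H.
Qed.

Lemma linear_le_norm (g : X -> Rstd) : linear_on setT g ->
  (forall v, g v <= vnorm v) -> is_blf g /\ dual_bound g 1.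
Proof.
move=> lg gle; have H x : `|g x| <= 1 * vnorm x.
  rewrite mul1r ler_norml gle andbT lerNl -mulN1r -(@linear_onZ _ _ setT) //.
  by rewrite -(vnormN x) -scaleN1r; apply: gle.
split; first by apply/is_blfE; split=> //; exists 1.
by apply/dual_boundE.
Qed.

Lemma norming_functional x :
  exists phi : X -> Rstd, [/\ is_blf phi, dual_bound phi 1 & phi x = vnorm x].
Proof.
have [x0|x0] := eqVneq (vnorm x) 0.
  exists (fun=> 0); split=> //; last 1 first.
  - by apply/dual_boundE; split=> // y; rewrite normr0 mul1r vnorm_ge0.
  - apply/is_blfE; split; first by move=> a u v; rewrite mulr0 addr0.
    by exists 0 => y; rewrite normr0 mul0r.
have [||||||g [lg gx gB]] := @hahn_banach_point _ X (fun v c => vnorm v <= c) _ _ _ _ x (vnorm x).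
- by rewrite vnorm0.
- by move=> u v c d uc vd; apply: le_trans (vnormD _ _) _; apply: lerD.
- by move=> a u c uc; rewrite vnormZ ler_wpM2l.
- by move=> u c; apply: le_trans; apply: vnorm_ge0.
- by rewrite lt0r x0 vnorm_ge0.
- by [].
by have [] := linear_le_norm lg (fun v => gB v _ (lexx _)); exists g.
Qed.

Lemma lincombE m (c : nat -> Rstd) (v : nat -> X) :
  lincomb m c v = \sum_(i < m) c i *: v i.
Proof. by elim: m => [|m IH]; rewrite ?big_ord0 // big_ord_recr /= IH. Qed.

End Norm.

(** * James' theorem *)

Lemma linear_on_sum (R : realType) (V : lmodType R) (W : V -> Prop) (f : V -> R) k
    (a : nat -> R) (v : nat -> V) :
  subspace W -> linear_on W f -> (forall i, W (v i)) ->
  W (\sum_(i < k) a i *: v i) /\ f (\sum_(i < k) a i *: v i) = \sum_(i < k) a i * f (v i).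
Proof.
move=> sW lf Wv; elim: k => [|k [IH1 IH2]].
  by rewrite !big_ord0; split; [case: sW|apply: linear_on0 lf].
rewrite !big_ord_recr /= addrC; split; first exact: sW.2.
by rewrite lf // IH2 addrC.
Qed.

Section Bidual.
Variables (Y : BanachSpace) (Phi : (Y -> Rstd) -> Rstd).
(** All functions on [Y] form the ambient module for Hahn-Banach; the dual is its subspace [blf]. *)
Let V := (Y -> Rstd^o).
Let blf : V -> Prop := @is_blf Y.

Let addE (phi psi : V) x : (phi + psi) x = phi x + psi x. Proof. by []. Qed.
Let scaleE a (phi : V) x : (a *: phi) x = a * phi x. Proof. by []. Qed.
Let zeroE x : (0 : V) x = 0. Proof. by []. Qed.
Let fE := (addE, scaleE, zeroE).

Lemma subspace_blf : subspace blf.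
Proof.
split.
  apply/is_blfE; split=> [a u v _ _|]; first by rewrite !fE mulr0 addr0.
  by exists 0 => x; rewrite fE normr0 mul0r.
move=> a phi psi /is_blfE[lphi [M HM]] /is_blfE[lpsi [N HN]]; apply/is_blfE; split.
  move=> b u v _ _; rewrite /= !fE /= lphi // lpsi //; ring.
exists (`|a| * M + N) => x; rewrite !fE /=; apply: le_trans (ler_normD _ _) _.
by rewrite normrM mulrDl -mulrA lerD // ler_wpM2l.
Qed.

Lemma linear_blf (phi : V) : blf phi -> linear_on setT phi.
Proof. by move=> /is_blfE[]. Qed.

Lemma blfB (phi : V) x y : blf phi -> phi (x - y) = phi x - phi y.
Proof.
by move=> /linear_blf lphi; rewrite -scaleN1r addrC lphi // mulN1r addrC.
Qed.

Lemma dual_boundZ (a : Rstd) (phi : V) c :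
  dual_bound phi c -> dual_bound (a *: phi : V) (`|a| * c).
Proof.
move=> /dual_boundE[c0 H]; apply/dual_boundE; split; first exact: mulr_ge0.
by move=> x; rewrite !fE normrM -mulrA ler_wpM2l.
Qed.

Lemma dual_boundD (phi psi : V) c d :
  dual_bound phi c -> dual_bound psi d -> dual_bound (phi + psi : V) (c + d).
Proof.
move=> /dual_boundE[c0 Hc] /dual_boundE[d0 Hd]; apply/dual_boundE.
split=> [|x]; first exact: addr_ge0.
by rewrite !fE; apply: le_trans (ler_normD _ _) _; rewrite mulrDl lerD.
Qed.

Lemma dual_bound0 : dual_bound (0 : V) 0.
Proof. by apply/dual_boundE; split=> // x; rewrite mul0r !fE normr0. Qed.

Lemma bidual_linear : is_bidual Phi -> linear_on blf (Phi : V -> Rstd).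
Proof.
move=> [PhiD [PhiZ _]] a phi psi bphi bpsi.
have -> : Phi (a *: phi + psi) = Phi (a *: phi : V) + Phi psi.
  by apply: (PhiD (a *: phi)) => //; apply: subspaceZ => //; exact: subspace_blf.
by congr (_ + _); exact: PhiZ.
Qed.

(** [Y] is complete, hence closed in its bidual: points [s n] within [1/(n+1)] of [Phi] would be
    Cauchy by norming functionals, and their limit would represent [Phi]. *)
Lemma bidual_far : is_bidual Phi -> ~ (exists x, forall phi, is_blf phi -> Phi phi = phi x) ->
  exists2 delta : Rstd, 0 < delta & forall y, exists phi c,
    [/\ is_blf phi, dual_bound phi c & delta * c < `|Phi phi - phi y|].
Proof.
move=> bPhi nrep; apply: contrapT => nfar; apply: nrep.
have near (d : Rstd) : 0 < d -> exists y, forall phi c, is_blf phi -> dual_bound phi c ->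
    `|Phi phi - phi y| <= d * c.
  move=> d0; apply: contrapT => ny; apply: nfar; exists d => // y.
  apply: contrapT => nphi; apply: ny; exists y => phi c bphi cphi.
  by rewrite leNgt; apply/negP => lt; apply: nphi; exists phi, c.
pose e n : Rstd := n.+1%:R^-1.
have e0 n : 0 < e n by rewrite invr_gt0 ltr0n.
pose s n := projT1 (cid (near _ (e0 n))).
have sP n phi c : is_blf phi -> dual_bound phi c -> `|Phi phi - phi (s n)| <= e n * c.
  by rewrite /s; case: cid => y /= H; apply: H.
have sD i j : vnorm (s i - s j) <= e i + e j.
  have [phi [bphi cphi <-]] := norming_functional (s i - s j).
  rewrite blfB //.
  have := sP i _ _ bphi cphi; have := sP j _ _ bphi cphi.
  rewrite !mulr1 !ler_norml => /andP[? ?] /andP[? ?]; lra.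
have e_lt (d : Rstd) : 0 < d -> exists N, forall i, (N <= i)%coq_nat -> e i < d.
  move=> d0; exists (Num.truncn d^-1) => i /ssrnat.leP Ni.
  rewrite invf_plt ?posrE ?ltr0n //; apply: lt_le_trans (truncnS_gt _) _.
  by rewrite ler_nat ltnS.
have [] := @vcomplete Y s.
  move=> d /RltP d0; have [|N HN] := e_lt (d / 2); first by rewrite divr_gt0.
  exists N => i j Ni Nj; apply/RltP; apply: le_lt_trans (sD i j) _.
  by have := HN i Ni; have := HN j Nj; lra.
move=> l sl; exists l => phi bphi; have /is_blfE[_ [M HM]] := bphi.
(* [M] may fail to be positive, and [c] is divided by below. *)
pose c := Num.max M 1.
have c0 : 0 < c by rewrite lt_max ltr01 orbT.
have cphi : dual_bound phi c.
  apply/dual_boundE; split=> [|x]; first exact: ltW.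
  by apply: le_trans (HM x) _; rewrite ler_wpM2r ?vnorm_ge0 // le_max lexx.
apply/eqP; rewrite -subr_eq0 -normr_le0; apply/ler_addgt0Pl => d d0; rewrite addr0.
have d2 : 0 < d / 2 / c by rewrite !divr_gt0.
have [N1 H1] := e_lt _ d2; have /RltP d2R := d2; have [N2 H2] := sl _ d2R.
pose i := maxn N1 N2; have /H1 ei : (N1 <= i)%coq_nat by apply/ssrnat.leP/leq_maxl.
have /H2/RltP sil : (N2 <= i)%coq_nat by apply/ssrnat.leP/leq_maxr.
have := sP i _ _ bphi cphi; have /dual_boundE[_ /(_ (s i - l))] := cphi.
rewrite blfB //.
have : e i * c < d / 2 by rewrite -ltr_pdivlMr.
have : c * vnorm (s i - l) < d / 2 by rewrite mulrC -ltr_pdivlMr.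
rewrite !ler_norml => ? ? /andP[? ?] /andP[? ?]; apply/andP; split; lra.
Qed.

(** Without such an [f], [Phi] has norm at most [delta] on the annihilator of the [x i]. A
    Hahn-Banach extension [Psi] keeps this bound, and [Phi - Psi] vanishes on the annihilator, so it
    is evaluation at a combination of the [x i]. That point is within [delta] of [Phi], against the
    last hypothesis. *)
Lemma annihilator_functional (delta : Rstd) k (x : nat -> Y) :
  is_bidual Phi -> 0 < delta ->
  (forall y, exists phi c,
    [/\ is_blf phi, dual_bound phi c & delta * c < `|Phi phi - phi y|]) ->
  exists f, [/\ is_blf f, dual_bound f 1, Phi f = delta &
                forall i, (i < k)%N -> f (x i) = 0].
Proof.
move=> bPhi d0 far; apply: contrapT => nf.
have lPhi := bidual_linear bPhi; have sblf := subspace_blf.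
pose F (phi : V) := blf phi /\ forall i, (i < k)%N -> phi (x i) = 0.
have sF : subspace F.
  split; first by split=> //; case: sblf.
  move=> a phi psi [bphi vphi] [bpsi vpsi]; split; first exact: sblf.2.
  by move=> i ik; rewrite !fE vphi // vpsi // mulr0 addr0.
(* The gauge is [delta] times the dual norm, and infinite off the bounded functionals. *)
pose B (phi : V) (c : Rstd) := blf phi /\ dual_bound phi (c / delta).
have FB phi c : F phi -> B phi c -> Phi phi <= c.
  move=> [bphi vphi] [_ cphi]; rewrite leNgt; apply/negP => cP.
  have /dual_boundE[c0 Hphi] := cphi.
  have P0 : 0 < Phi phi.
    by apply: le_lt_trans cP; rewrite pmulr_lge0 ?invr_gt0 in c0.
  (* Rescaled to the value [delta], [phi] becomes a functional excluded by [nf]. *)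
  pose f : V := (delta / Phi phi) *: phi.
  have Ff : F f by apply: subspaceZ => //; split.
  apply: nf; exists f; split; first by case: Ff.
  - apply/dual_boundE; split=> // y.
    rewrite /f !fE normrM gtr0_norm ?divr_gt0 // -lter_pdivlMl ?divr_gt0 //.
    apply: le_trans (Hphi y) _; rewrite mul1r ler_wpM2r ?vnorm_ge0 //.
    by rewrite invf_div ler_pM2r ?invr_gt0 // ltW.
  - rewrite /f (@linear_onZ _ _ blf) //; first by field; rewrite gt_eqF.
  - by case: Ff.
have [||||Psi [lPsi PsiF PsiB]] := @hahn_banach _ V B _ _ _ F Phi sF _ FB.
- split; first by case: sblf.
  by rewrite mul0r; exact: dual_bound0.
- move=> phi psi c d [? ?] [? ?]; split; last by rewrite mulrDl; exact: dual_boundD.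
  by rewrite -[phi]scale1r; apply: sblf.2.
- move=> a phi c [? ?]; split; first exact: subspaceZ.
  by rewrite -mulrA; exact: dual_boundZ.
- by move=> a phi psi [bphi _] [bpsi _]; apply: lPhi.
have [|||a aP] := @vanish_on_kernels _ V blf k (fun i phi => phi (x i))
  (fun phi => Phi phi - Psi phi) sblf.
- by move=> i b phi psi _ _; rewrite !fE.
- by move=> b phi psi bphi bpsi; rewrite lPhi // lPsi //; ring.
- by move=> phi bphi vphi; rewrite PsiF ?subrr.
have [phi [c [bphi cphi]]] := far (\sum_(i < k) a i *: x i).
have [_ ->] := @linear_on_sum _ _ setT phi k a x
  (conj I (fun _ _ _ _ _ => I)) (linear_blf bphi) (fun _ => I).
rewrite -aP // opprB addrC subrK ltNge => /negP; apply.
have Bphi : B phi (delta * c) by split=> //; rewrite mulrC mulKf // gt_eqF.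
rewrite ler_norml PsiB // andbT lerNl -mulN1r -(@linear_onZ _ _ setT Psi) //.
apply: PsiB; split; first exact: subspaceZ.
have := dual_boundZ (-1) Bphi.2; by rewrite normrN1 mul1r.
Qed.

(** No control of the norm yet. If [fs k] vanishes on the common kernel of the earlier functionals,
    it is a combination of them, and [x] already has the right value. *)
Lemma bidual_interpolation k (fs : nat -> Y -> Rstd) : is_bidual Phi ->
  (forall i, is_blf (fs i)) -> exists x, forall i, (i < k)%N -> fs i x = Phi (fs i).
Proof.
move=> bPhi bfs; elim: k => [|k [x xP]]; first by exists 0.
have lfs i := linear_blf (bfs i).
have [[z [zk fz]]|nz] := pselect (exists z, (forall i, (i < k)%N -> fs i z = 0) /\ fs k z != 0).
  exists (((Phi (fs k) - fs k x) / fs k z) *: z + x) => i.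
  rewrite ltnS leq_eqVlt lfs // => /orP[/eqP->|ik]; first by field.
  by rewrite (zk i ik) (xP i ik) mulr0 add0r.
exists x => i; rewrite ltnS leq_eqVlt => /orP[/eqP->|/xP//].
have [||a aP] := @vanish_on_kernels _ Y setT k fs (fs k) _ lfs (lfs k).
- by split.
- move=> v _ vk; apply: contrapT => /eqP fv; apply: nz; by exists v.
have fsE : fs k = \sum_(i < k) a i *: (fs i : V).
  by apply/funext => v; rewrite aP // fct_sumE.
have [_ PhiE] := linear_on_sum k a subspace_blf (bidual_linear bPhi) bfs.
by rewrite aP // [in RHS]fsE PhiE; apply: eq_bigr => j _; rewrite xP.
Qed.

(** Helly's theorem. If all solutions were longer than [M + 1], Hahn-Banach modulo the common kernel
    would give [g] of norm at most 1 with [g x = M + 1]. Being a combination of the [fs i], it has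
    [Phi g = g x], more than [M] allows. *)
Lemma helly (M : Rstd) k (fs : nat -> Y -> Rstd) : is_bidual Phi -> 0 <= M ->
  (forall phi c, is_blf phi -> dual_bound phi c -> `|Phi phi| <= M * c) ->
  (forall i, is_blf (fs i)) ->
  exists x, vnorm x <= M + 1 /\ forall i, (i < k)%N -> fs i x = Phi (fs i).
Proof.
move=> bPhi M0 HM bfs; have lfs i := linear_blf (bfs i).
have [x xP] := bidual_interpolation k bPhi bfs; apply: contrapT => nx.
pose F z := forall i, (i < k)%N -> fs i z = 0.
have sF : subspace F.
  split=> [i ik|a u v Fu Fv i ik]; first by rewrite (@linear_on0 _ _ setT).
  by rewrite lfs // Fu // Fv // mulr0 addr0.
(* The quotient norm modulo [F]. *)
pose B v c := exists z, F z /\ vnorm (v + z) <= c.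
have [|||||c|g [lg gx gB]] := @hahn_banach_point _ Y B _ _ _ _ x (M + 1).
- by exists 0; rewrite addr0 vnorm0; split=> //; case: sF.
- move=> u v c d [y [Fy uy]] [z [Fz vz]]; exists (y + z); split.
    by rewrite -[y]scale1r; apply: sF.2.
  by rewrite addrACA; apply: le_trans (vnormD _ _) _; apply: lerD.
- move=> a u c [y [Fy uy]]; exists (a *: y); split; first exact: (@subspaceZ _ _ F).
  by rewrite -scalerDr vnormZ ler_wpM2l.
- by move=> u c [y [_]]; apply: le_trans; exact: vnorm_ge0.
- by rewrite ltr_wpDl.
- move=> [z [Fz xz]]; rewrite leNgt; apply/negP => cM; apply: nx; exists (x + z).
  split; first by apply: le_trans xz _; exact: ltW.
  by move=> i ik; rewrite -[x]scale1r lfs // mul1r xP // Fz // addr0.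
have [bg cg] : is_blf g /\ dual_bound g 1.
  by apply: linear_le_norm => // v; apply: gB; exists 0; rewrite addr0; split=> //; case: sF.
have gF z : F z -> g z = 0.
  have le y : F y -> g y <= 0.
    move=> Fy; apply: gB; exists (- y); rewrite subrr vnorm0; split=> //.
    by rewrite -scaleN1r; exact: (@subspaceZ _ _ F).
  move=> Fz; apply/eqP; rewrite eq_le le //= -oppr_le0 -mulN1r -(@linear_onZ _ _ setT g) //.
  by apply: le; exact: (@subspaceZ _ _ F).
have [||a aP] := @vanish_on_kernels _ Y setT k fs g _ lfs lg; first by split.
  by move=> v _ /gF.
have gE : g = \sum_(i < k) a i *: (fs i : V).
  by apply/funext => v; rewrite aP // fct_sumE.
have [_ PhiE] := linear_on_sum k a subspace_blf (bidual_linear bPhi) bfs.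
have : Phi g = g x.
  by rewrite aP // [in LHS]gE PhiE; apply: eq_bigr => j _; rewrite xP.
rewrite gx => Pg; have := HM _ _ bg cg; rewrite Pg mulr1 => /(le_trans (ler_norm _)); lra.
Qed.

End Bidual.

(** Functionals and vectors are chosen in turn: a new functional kills the earlier vectors and has
    [Phi]-value [delta]; by Helly's theorem a new vector agrees with [Phi] on all functionals so
    far. *)
Theorem james (Y : BanachSpace) : ~ Defs.reflexive Y ->
  exists delta K : Rstd, 0 < delta /\ forall N, exists (x : nat -> Y) (f : nat -> Y -> Rstd),
    [/\ forall i, (i < N)%N -> vnorm (x i) <= K,
        forall i, is_blf (f i) /\ dual_bound (f i) 1 &
        forall i j, (i < N)%N -> (j < N)%N -> f i (x j) = if (i <= j)%N then delta else 0].
Proof.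
move=> nrefl.
have [Phi [bPhi nrep]] : exists Phi, @is_bidual Y Phi /\
    ~ (exists x, forall phi, is_blf phi -> Phi phi = phi x).
  by apply: contrapT => H; apply: nrefl => Phi bPhi; apply: contrapT => nx; apply: H; exists Phi.
have [delta d0 far] := bidual_far bPhi nrep.
have [M [M0 HM]] : exists M : Rstd, 0 <= M /\
    forall phi c, is_blf phi -> dual_bound phi c -> `|Phi phi| <= M * c.
  have [_ [_ [M HM]]] := bPhi; exists (Num.max M 0); split; first by rewrite le_max lexx orbT.
  move=> phi c bphi cphi; have /RleP := HM _ _ bphi cphi; rewrite RabsE => /le_trans -> //.
  by rewrite ler_wpM2r ?le_max ?lexx //; have /dual_boundE[] := cphi.
exists delta, (M + 1); split=> // N.
suff [x [f [xK bf Pf fx]]] : exists (x : nat -> Y) (f : nat -> Y -> Rstd),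
    [/\ forall i, (i < N)%N -> vnorm (x i) <= M + 1,
        forall i, is_blf (f i) /\ dual_bound (f i) 1,
        forall i, (i < N)%N -> Phi (f i) = delta &
        forall i j, (i < N)%N -> (j < N)%N -> f i (x j) = if (i <= j)%N then delta else 0].
  by exists x, f.
elim: N => [|N [x [f [xK bf Pf fx]]]].
  have [f [bf cf _ _]] := annihilator_functional 0 (fun=> 0) bPhi d0 far.
  by exists (fun=> 0), (fun=> f); split.
have [g [bg cg Pg gx]] := annihilator_functional N x bPhi d0 far.
pose f' i := if i == N then g else f i.
have bf' i : is_blf (f' i) /\ dual_bound (f' i) 1 by rewrite /f'; case: eqP.
have Pf' i : (i < N.+1)%N -> Phi (f' i) = delta.
  by rewrite /f' ltnS leq_eqVlt; case: eqP => // _ /Pf.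
have [z [zM zf]] := helly N.+1 bPhi M0 HM (fun i => (bf' i).1).
exists (fun i => if i == N then z else x i), f'; split=> //.
  by move=> i; rewrite ltnS leq_eqVlt; case: eqP => //= _; apply: xK.
move=> i j iN; rewrite ltnS leq_eqVlt; case: eqP => [-> _|_ /= jN].
  by rewrite zf // Pf' // -ltnS iN.
rewrite /f'; case: eqP => [->|/eqP ni]; first by rewrite leqNgt jN gx.
by apply: fx => //; rewrite ltnS leq_eqVlt (negbTE ni) in iN.
Qed.

(** In a nonreflexive [Y] finitely representable in [X], applying [f k] to a combination of James'
    vectors gives [delta] times the tail sum of its coefficients. The transfer to [X], with
    [eps = 1], doubles [K]. *)
Theorem summing_sequences (X : BanachSpace) : ~ superreflexive X ->
  exists delta K : Rstd, 0 < delta /\ forall N, exists x : nat -> X,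
    (forall i, (i < N)%N -> vnorm (x i) <= K) /\
    (forall (c : nat -> Rstd) k, 
      delta * `|\sum_(i < N | (k <= i)%N) c i| <= vnorm (\sum_(i < N) c i *: x i)).
Proof.
move=> nX; have [Y [YX nY]] : exists Y, fin_representable Y X /\ ~ Defs.reflexive Y.
  by apply: contrapT => H; apply: nX => Y YX; apply: contrapT => nY; apply: H; exists Y.
have [delta [K [d0 HY]]] := james nY; exists delta, (2 * K); split=> // N.
have [y [f [yK bf fy]]] := HY N.
have /RltP lt01 := @ltr01 Rstd; have [x xP] := @YX N y _ lt01.
have xP1 (c : nat -> Rstd) : vnorm (\sum_(i < N) c i *: y i) <= vnorm (\sum_(i < N) c i *: x i).
  by have [/RleP] := xP c; rewrite !lincombE.
have xP2 (c : nat -> Rstd) : vnorm (\sum_(i < N) c i *: x i) <= 2 * vnorm (\sum_(i < N) c i *: y i).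
  by have [_ /RleP] := xP c; rewrite !lincombE.
exists x; split=> [i iN|c k].
  pose c j : Rstd := (j == i)%:R.
  have E (Z : BanachSpace) (z : nat -> Z) : \sum_(j < N) c j *: z j = z i.
    rewrite (bigD1 (Ordinal iN)) //= /c eqxx scale1r big1 ?addr0 // => j.
    by rewrite -val_eqE /= => /negbTE->; rewrite scale0r.
  by have := xP2 c; rewrite !E => /le_trans; apply; rewrite ler_pM2l // yK.
apply: le_trans (xP1 c).
have [kN|Nk] := ltnP k N; last first.
  rewrite big_pred0 ?normr0 ?mulr0 ?vnorm_ge0 // => i.
  by apply/negbTE; rewrite -ltnNge (leq_trans (ltn_ord i)).
have [bk /dual_boundE[_ ck]] := bf k.
have := ck (\sum_(i < N) c i *: y i); rewrite mul1r; apply: le_trans.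
have [_ ->] := @linear_on_sum _ _ setT (f k) N c y
  (conj I (fun _ _ _ _ _ => I)) (linear_blf bk) (fun _ => I).
rewrite -[X in X * _](gtr0_norm d0) -normrM mulrC mulr_suml [X in `|X| <= _]big_mkcond /=.
rewrite le_eqVlt; apply/orP; left; apply/eqP; congr `|_|; apply: eq_bigr => i _.
by rewrite fy //; case: ifP => // _; rewrite mulr0.
Qed.

(** * Numbering the words *)

Section WordCodes.
Variable B : nat.
Implicit Types w P : seq nat.

(* Padded base-[B] expansion with digits shifted by one: the words extending a
   given prefix get exactly the codes of an interval. *)
Fixpoint code H w : nat :=
  match H, w with
  | H'.+1, b :: w' => (b.+1 * B ^ H' + code H' w')%N
  | _, _ => 0%N
  end.

Let digits w := all (fun b => b.+1 < B)%N w.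

(** The codes of the extensions of [w] stay below [B ^ H]; this keeps words with different first
    letters apart. *)
Lemma code_lt H w : (0 < B)%N -> digits w -> (size w <= H)%N ->
  (code H w + B ^ (H - size w) <= B ^ H)%N.
Proof.
move=> B0; elim: H w => [|H IH] [|b w] //= /andP[bB dw]; rewrite ltnS subSS => wH.
have := IH w dw wH; rewrite expnS => ?.
have : (b.+2 * B ^ H <= B * B ^ H)%N by rewrite leq_mul2r bB orbT.
by rewrite mulSn; lia.
Qed.

Lemma code_interval H P w : (0 < B)%N -> digits P -> digits w ->
  (size P <= H)%N -> (size w <= H)%N ->
  (code H P <= code H w < code H P + B ^ (H - size P))%N = prefix P w.
Proof.
move=> B0; elim: H P w => [|H IH] [|b P] [|c w] //=.
- by move=> _ _ _ _; rewrite expn_gt0 B0.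
- move=> _ dw _ wH; rewrite add0n subn0.
  have := @code_lt H.+1 (c :: w) B0 dw wH; rewrite /= subSS.
  by have : (0 < B ^ (H - size w))%N; [rewrite expn_gt0 B0|lia].
(* The shift of digits matters here: a nonempty [P] has positive code, the empty word code 0. *)
- move=> _ _ _ _; rewrite leqn0 addn_eq0 muln_eq0 /= -leqn0 leqNgt expn_gt0 B0 //.
move=> /andP[bB dP] /andP[cB dw]; rewrite !ltnS subSS => PH wH.
have lP := code_lt B0 dP PH; have lw := code_lt B0 dw wH.
have p0 : (0 < B ^ (H - size w))%N by rewrite expn_gt0 B0.
(* Different first letters put the codes into disjoint blocks of length [B ^ H]. *)
have [bc|cb|->] := ltngtP b c.
- have : (b.+2 * B ^ H <= c.+1 * B ^ H)%N by apply: leq_mul.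
  rewrite mulSn /=; lia.
- have : (c.+2 * B ^ H <= b.+1 * B ^ H)%N by apply: leq_mul.
  rewrite mulSn /=; lia.
- by rewrite /= -(IH P w) //; lia.
Qed.

(** The number of nonempty prefixes of [w] that extend [P]. *)
Definition prefix_count P w := count (fun j => prefix P (take j w)) (iota 1 (size w)).

Lemma prefix_count_nil w : prefix_count [::] w = size w.
Proof.
by rewrite /prefix_count (eq_count (a2 := predT)) ?count_predT ?size_iota // => j; rewrite prefix0s.
Qed.

Lemma prefix_count_take p w : (0 < p <= size w)%N ->
  prefix_count (take p w) w = (size w - p).+1.
Proof.
move=> /andP[p0 pw]; rewrite /prefix_count.
rewrite -(@eq_in_count _ (fun j => p <= j)%N); last first.
  move=> j; rewrite mem_iota => /andP[_ jw].
  have sj : size (take j w) = j by rewrite size_takel //; lia.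
  apply/idP/idP => [pj|].
    by rewrite -(take_takel w pj) prefix_take.
  by move/size_prefix; rewrite sj size_takel.
have -> : iota 1 (size w) = iota 1 p.-1 ++ iota p (size w - p).+1.
  have -> : size w = (p.-1 + (size w - p).+1)%N by lia.
  by rewrite iotaD; congr (_ ++ iota _ _); lia.
rewrite count_cat (eq_in_count (a2 := pred0)) ?count_pred0; last first.
  by move=> j; rewrite mem_iota /=; lia.
rewrite (eq_in_count (a2 := predT)) ?count_predT ?size_iota // => j.
by rewrite mem_iota /=; lia.
Qed.

Lemma prefix_count_eq0 P w : ~~ prefix P w -> prefix_count P w = 0%N.
Proof.
move=> nP; rewrite /prefix_count (eq_count (a2 := pred0)) ?count_pred0 // => j.
apply/negbTE; apply: contra nP => Pj; apply: prefix_trans Pj _; exact: prefix_take.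
Qed.

End WordCodes.

(** * Distances on the cycle *)

Section CyclicGeometry.
Variable n : nat.
Hypothesis n_gt1 : (1 < n)%N.
Implicit Types c k l e : 'Z_n.

(** The number of forward moves from [k] to [l]. *)
Definition arc k l : nat := (l - k)%R.

Lemma Zp_natr_n : n%:R = 0 :> 'Z_n.
Proof. by apply: val_inj; rewrite /= val_Zp_nat // modnn. Qed.

Lemma arc_lt k l : (arc k l < n)%N.
Proof. by rewrite -[X in (_ < X)%N](Zp_cast n_gt1) ltn_ord. Qed.

Lemma arcK k l : k + (arc k l)%:R = l.
Proof. by rewrite /arc natr_Zp addrC subrK. Qed.

Lemma arc_natr k a : (a < n)%N -> arc k (k + a%:R) = a.
Proof. by move=> an; rewrite /arc addrC addKr val_Zp_nat // modn_small. Qed.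

Lemma arc_succ k : arc k (k + 1) = 1%N.
Proof. exact: (@arc_natr k 1). Qed.

Lemma arc_natr_sub k a : (a < n)%N -> arc (k - a%:R) k = a.
Proof. by move=> an; rewrite -[X in arc _ X](subrK a%:R k) arc_natr. Qed.

Lemma arc0 k l : (arc k l == 0%N) = (k == l).
Proof.
apply/eqP/eqP => [a0|->]; last by rewrite /arc subrr.
by rewrite -(arcK k l) a0 addr0.
Qed.

Lemma arc_trans k l e :
  arc k e = (arc k l + arc l e)%N \/ (arc k e + n = arc k l + arc l e)%N.
Proof.
have := arc_lt k l; have := arc_lt l e.
have E : k + (arc k l + arc l e)%:R = e by rewrite natrD addrA !arcK.
have [lt _ _|ge ? ?] := ltnP (arc k l + arc l e) n.
  by left; rewrite -[in LHS]E arc_natr.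
right; rewrite -[in LHS]E -(subnK ge) natrD Zp_natr_n addr0 arc_natr ?subnK //; lia.
Qed.

Lemma arc_sym k l : k != l -> (arc k l + arc l k = n)%N.
Proof.
move=> kl; have := kl; rewrite -arc0 => k0.
by have := arc_trans k l k; have /eqP := etrans (arc0 k k) (eqxx k); lia.
Qed.

Definition hops k l := minn (arc k l) (n - arc k l).

(** The lamp on the [i]-th edge met from [c], forwards if [s] and backwards otherwise; the [+ 1] is
    due to lamp [e] sitting on the edge that ends at [e]. *)
Definition lamp (s : bool) c i : 'Z_n := if s then c + i%:R else c - i%:R + 1.

(** Moves from [k] that cross the edge of lamp [e]: forwards to [e], or backwards to [e - 1].
    Measuring from [k + 1] makes the forward count for [e = k] a full turn. *)
Definition lamp_hops k e := minn (arc (k + 1) e).+1 (n - arc (k + 1) e).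

Definition cut_gap := ((n + 7) %/ 8)%N.
Definition cut i : 'Z_n := (i * cut_gap)%:R.

Lemma cut_hit lo : exists i t,
  [/\ (i < 8)%N, (t < cut_gap)%N & cut i = (lo + t)%:R].
Proof.
rewrite /cut; have : (n <= 8 * cut_gap <= n + 7)%N by rewrite /cut_gap; lia.
move: cut_gap => g /andP[ng gn].
have lo_mod t : (lo + t)%:R = (lo %% n + t)%:R :> 'Z_n.
  by rewrite {1}(divn_eq lo n) !natrD natrM Zp_natr_n mulr0 add0r.
have : (lo %% n < n)%N by rewrite ltn_mod; lia.
move: (lo %% n)%N lo_mod => l lo_mod ln.
have g0 : (0 < g)%N by lia.
(* If the window from [l] ends before [n], its last multiple of [g] is a cut; otherwise it contains
   [n], which is the cut 0. *)
case: (ltnP (l + g - 1) n) => hl.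
  have E : ((l + g - 1) %/ g * g <= l + g - 1)%N by exact: leq_divM.
  have E2 : (l + g - 1 < ((l + g - 1) %/ g).+1 * g)%N by rewrite ltn_ceil.
  set i := ((l + g - 1) %/ g)%N in E E2 *; rewrite mulSn in E2.
  exists i, (i * g - l)%N; split; rewrite ?lo_mod; [|lia|congr _%:R; lia].
  by rewrite -(@ltn_pmul2r g); lia.
exists 0%N, (n - l)%N; split; [by []|lia|].
by rewrite lo_mod mul0n subnKC ?Zp_natr_n //; lia.
Qed.

(* As functions of [c = arc k (cut i)], the quantities to be bounded below are, up
   to rounding, [2c - r] and [n + r - 2c]; the window makes both at least [r/8]. *)
Lemma cut_cw k r : (0 < r)%N -> (2 * r <= n + 1)%N ->
  exists2 i, (i < 8)%N & (9 * r <= 16 * arc k (cut i) <= 8 * n + 7 * r)%N.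
Proof.
move=> r0 rn; pose a := ((9 * r + 15) %/ 16)%N.
have [i [t [i8 tg ct]]] := cut_hit (k + a).
exists i => //; rewrite ct -addnA natrD natr_Zp arc_natr.
all: by move: tg; rewrite /cut_gap /a; lia.
Qed.

Lemma cut_ccw k r : (0 < r)%N -> (2 * r <= n + 1)%N ->
  exists2 i, (i < 8)%N & (9 * r <= 16 * arc (cut i) k <= 8 * n + 7 * r)%N.
Proof.
(* The window runs from [k - b] to [k - a]; [n - b] keeps its start a natural number. *)
move=> r0 rn; pose a := ((9 * r + 15) %/ 16)%N; pose b := (a + cut_gap - 1)%N.
have bn : (b <= n)%N by rewrite /b /a /cut_gap; lia.
have [i [t [i8 tg ct]]] := cut_hit (k + (n - b)).
have tb : (t <= b)%N by move: tg; rewrite /b /a; lia.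
have E : k = cut i + (b - t)%:R.
  rewrite ct -natrD (_ : _ + _ = k + n)%N; last by lia.
  by rewrite natrD Zp_natr_n addr0 natr_Zp.
exists i => //; rewrite [X in arc _ X]E arc_natr.
all: by move: tg tb; rewrite /b /cut_gap /a; lia.
Qed.

Lemma hops_sym k l : hops k l = hops l k.
Proof.
rewrite /hops; have [->//|/arc_sym] := eqVneq k l; lia.
Qed.

(** The distances to [k] and [l] nearly agree only around the midpoints of the two arcs between
    them, and the window of [cut_cw] avoids both. *)
Lemma hops_far k l : exists2 i, (i < 8)%N &
  (8 * hops (cut i) k + hops k l <= 8 * hops (cut i) l)%N ||
  (8 * hops (cut i) l + hops k l <= 8 * hops (cut i) k)%N.
Proof.
have [->|] := eqVneq k l.
  by exists 0%N => //; rewrite /hops; have /eqP := etrans (arc0 l l) (eqxx l); lia.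
wlog le_kl : k l / (arc k l <= arc l k)%N.
  move=> H kl; case: (leqP (arc k l) (arc l k)) => [/H|/ltnW/H]; first exact.
  by rewrite eq_sym => /(_ kl) [i i8]; rewrite (hops_sym l k) orbC; exists i.
move=> kl; have s_kl := arc_sym kl.
have d0 : (0 < arc k l)%N by rewrite lt0n arc0.
have [||i i8 /andP[lo hi]] := @cut_cw k (arc k l); [by []|lia|].
exists i => //; have kc : k != cut i by rewrite -arc0; lia.
have := arc_sym kc; have := arc_trans (cut i) k l; have := arc_lt k (cut i).
have := arc_lt (cut i) l.
rewrite /hops; lia.
Qed.

(** The last bound concerns the number of letters from lamp [e] to the end of the word. The cut is
    taken on the side of [k] on which [e] is nearer. *)
Lemma lamp_far k e : exists i s p,
  [/\ (i < 8)%N, (0 < p <= hops (cut i) k)%N, lamp s (cut i) p = e &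
      (lamp_hops k e <= 8 * (hops (cut i) k - p).+1)%N].
Proof.
have := arc_lt (k + 1) e; have := arcK (k + 1) e.
rewrite /lamp_hops; set a := arc _ _ => ae an.
have [le|gt] := leqP a.+1 (n - a).
  have [||i i8 /andP[lo hi]] := @cut_cw k a.+1; [by []|lia|].
  have cE := arcK k (cut i).
  have kc : k != cut i by rewrite -arc0; lia.
  have := arc_sym kc; have := arc_lt k (cut i); rewrite /hops.
  move: (arc k (cut i)) lo hi cE => C lo hi cE Cn sC.
  (* A lamp between [k] and the cut is read backwards from the cut, one beyond it forwards. *)
  have [rC|Cr] := leqP a.+1 C.
    exists i, false, (C - a)%N; split=> //; [lia| |lia].
    by rewrite /lamp -cE -ae natrB; [ring|lia].
  exists i, true, (a.+1 - C)%N; split=> //; [lia| |lia].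
  by rewrite /lamp -cE -ae natrB; [rewrite -natr1; ring|lia].
have [||i i8 /andP[lo hi]] := @cut_ccw k (n - a)%N; [lia|lia|].
have cE := arcK (cut i) k; have Cn := arc_lt (cut i) k.
have [C CE] : exists C, arc (cut i) k = C by exists (arc (cut i) k).
rewrite CE in lo hi cE Cn.
have Ea : a%:R = - (n - a)%:R :> 'Z_n.
  by rewrite natrB ?Zp_natr_n ?sub0r ?opprK //; lia.
have [rC|Cr] := leqP (n - a) C.
  exists i, true, (C - (n - a)).+1; rewrite /hops CE; split=> //; [lia| |lia].
  by rewrite /lamp -ae -cE Ea -natr1 natrB //; ring.
exists i, false, (n - a - C)%N; rewrite /hops CE; split=> //; [lia| |lia].
by rewrite /lamp -ae -cE Ea [in LHS]natrB; [ring|lia].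
Qed.

Lemma hops_succ c k :
  (hops c (k + 1)%R <= (hops c k).+1)%N /\ (hops c k <= (hops c (k + 1)%R).+1)%N.
Proof.
have := arc_trans c k (k + 1); have := arc_succ k.
have := arc_lt c k; have := arc_lt c (k + 1); rewrite /hops; lia.
Qed.

(** Were the edge from [k] to [k + 1] the [i]-th one from [c], one of its ends would be at distance
    at most [i - 1] from [c]. *)
Lemma lamp_off_step s c k i :
  (0 < i)%N -> (i <= hops c k)%N -> (i <= hops c (k + 1)%R)%N -> lamp s c i != k + 1.
Proof.
move=> i0 ik ik1; apply/eqP; have := arc_trans c k (k + 1); have := arc_succ k.
have := arc_lt c k; have := arc_lt c (k + 1).
have iN : (i < n)%N by move: ik; rewrite /hops; lia.
case: s => /= [? ? ? ? E|? ? ? ? E].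
  by have := arc_natr c iN; rewrite E; move: ik ik1; rewrite /hops; lia.
have Ek : c - i%:R = k by apply: (addIr 1).
have := arc_natr_sub c iN; rewrite Ek => kc.
have k_c : k != c by rewrite -arc0 kc; lia.
have := arc_sym k_c; move: ik ik1; rewrite /hops; lia.
Qed.

End CyclicGeometry.

(** * Words of the lamplighter group *)

Section Lamplighter.
Variable n : nat.
Hypothesis n_gt1 : (1 < n)%N.
Implicit Types (u v w : LL n) (x y z : {set 'Z_n}) (k l e c : 'Z_n).

Lemma in_symd x y e : (e \in symd x y) = ((e \in x) (+) (e \in y)).
Proof. by rewrite /symd !inE; case: (e \in x); case: (e \in y). Qed.

Lemma LLmul_t u : LLmul u (gen_t n) = (u.1, u.2 + 1).
Proof.
by congr pair; apply/setP => e; rewrite in_symd imset0 inE addbF.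
Qed.

Lemma LLmul_ta u : LLmul u (gen_ta n) = (symd u.1 [set u.2 + 1], u.2 + 1).
Proof.
have -> : gen_ta n = ([set 1], 1).
  rewrite /gen_ta /LLmul /= addr0 imset_set1 addr0; congr pair.
  by apply/setP => e; rewrite in_symd inE.
by rewrite /LLmul /= imset_set1.
Qed.

(** Right multiplication by either generator: they differ only in lamp [u.2 + 1], whose state is
    left free. *)
Definition step u v :=
  v.2 = u.2 + 1 /\ forall e, e != u.2 + 1 -> (e \in u.1) = (e \in v.1).

Lemma stepP u v : reflect (step u v) ((v == LLmul u (gen_t n)) || (v == LLmul u (gen_ta n))).
Proof.
rewrite LLmul_t LLmul_ta; apply: (iffP orP) => [[]/eqP->|[v2 v1]] /=.
- by split.
- by split=> //= e ne; rewrite in_symd inE (negbTE ne) addbF.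
have [E|E] := eqVneq (u.2 + 1 \in u.1) (u.2 + 1 \in v.1); [left|right].
all: apply/eqP; case: v => y l /= in v1 v2 E *; rewrite v2; congr pair.
all: apply/setP => e; rewrite ?in_symd ?inE; have [->|ne] := eqVneq e (u.2 + 1).
- by rewrite E.
- by rewrite v1.
- by move: E; do 2 case: (_ \in _).
- by rewrite addbF v1.
Qed.

Lemma cay_adjP u v : reflect (step u v \/ step v u) (cay_adj u v).
Proof.
apply: (iffP idP) => [/or4P[]H|[/stepP/orP[]|/stepP/orP[]]H]; last 4 first.
- by apply/or4P; apply: Or42.
- by apply/or4P; apply: Or44.
- by apply/or4P; apply: Or41.
- by apply/or4P; apply: Or43.
- by right; apply/stepP; rewrite H.
- by left; apply/stepP; rewrite H.
- by right; apply/stepP; rewrite H orbT.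
- by left; apply/stepP; rewrite H orbT.
Qed.

(** * Walks in the Cayley graph *)

Definition reach m u v :=
  exists p, [/\ path (@cay_adj n) u p, last u p = v & size p = m].

Lemma reach0 u : reach 0 u u.
Proof. by exists [::]. Qed.

Lemma reach_trans m m' u v w : reach m u v -> reach m' v w -> reach (m + m') u w.
Proof.
move=> [p [up <- <-]] [q [vq <- <-]]; exists (p ++ q); split.
- by rewrite cat_path up.
- by rewrite last_cat.
- by rewrite size_cat.
Qed.

Lemma reach1 u v : step u v \/ step v u -> reach 1 u v.
Proof. by move=> /cay_adjP uv; exists [:: v]; rewrite /= uv. Qed.

Lemma reach_sym m u v : reach m u v -> reach m v u.
Proof.
move=> [p [up <- <-]]; elim: p u up => [|w p IH] u /=; first by move=> _; exact: reach0.
move=> /andP[/cay_adjP uw wp]; rewrite -addn1; apply: reach_trans (IH w wp) _.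
by apply: reach1; case: uw; [right|left].
Qed.

Lemma reach_forward m x y k :
  (forall e, (e \in x) != (e \in y) -> exists2 i, (0 < i <= m)%N & e = k + i%:R) ->
  reach m (x, k) (y, k + m%:R).
Proof.
elim: m x k => [|m IH] x k xy.
  rewrite addr0 (_ : x = y); first exact: reach0.
  apply/setP => e; apply/eqP; apply: contraT => /xy[i]; lia.
pose x' := [set e | if e == k + 1 then e \in y else e \in x].
rewrite -add1n natrD addrA; apply: (@reach_trans _ _ _ (x', k + 1)).
  by apply: reach1; left; split=> //= e ne; rewrite inE (negbTE ne).
apply: IH => e; rewrite inE; have [_|ne /xy[i im eE]] := eqVneq e (k + 1); first by rewrite eqxx.
have i1 : (1 < i)%N.
  rewrite ltn_neqAle eq_sym; case/andP: im => -> _; rewrite andbT.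
  by apply: contraNneq ne => i1; rewrite eE i1.
exists i.-1; first by lia.
by rewrite eE -addrA [1 + _]addrC natr1 prednK //; lia.
Qed.

(** From [k] the walk goes [r] forwards and back, [r] backwards and back, then the shorter way to
    [l]. The first leg corrects the lamps ahead, leaving [z]; the backward leg corrects the
    others. *)
Lemma reach_le x y k l r :
  (forall e, (e \in x) != (e \in y) -> (lamp_hops k e <= r)%N) ->
  reach (4 * r + hops k l) (x, k) (y, l).
Proof.
move=> xy; pose z := [set e | if (arc (k + 1)%R e < r)%N then e \in y else e \in x].
have move_only t a b : reach a (t, b) (t, b + a%:R).
  by apply: reach_forward => e; rewrite eqxx.
have -> : (4 * r + hops k l = (r + r) + (r + r) + hops k l)%N by lia.
have back t : reach r (t, k - r%:R) (t, k).
  by rewrite -[X in reach _ _ (_, X)](subrK r%:R k).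
apply: (@reach_trans _ _ _ (y, k)); last first.
  rewrite /hops; have [_|_] := leqP (arc k l) (n - arc k l).
    by rewrite -[X in reach _ _ (_, X)](arcK k l).
  have [->|kl] := eqVneq k l.
    have /eqP -> := etrans (arc0 l l) (eqxx l).
    have := move_only y n l; rewrite subn0 Zp_natr_n // addr0; exact.
  have <- : arc l k = (n - arc k l)%N by have := arc_sym n_gt1 kl; lia.
  by apply: reach_sym; rewrite -[X in reach _ _ (_, X)](arcK l k).
apply: (@reach_trans _ _ _ (z, k)).
  apply: (@reach_trans _ _ _ (z, k + r%:R)); last exact/reach_sym/move_only.
  apply: reach_forward => e; rewrite inE; case: ifP => [ar _|_]; last by rewrite eqxx.
  exists (arc (k + 1)%R e).+1; first by rewrite ar.
  by rewrite -natr1 [in RHS]addrA -[LHS](arcK (k + 1) e) addrAC.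
apply: (@reach_trans _ _ _ (y, k - r%:R)); last exact: back.
apply: reach_sym; rewrite -[X in reach _ _ (_, X)](subrK r%:R k).
apply: reach_forward => e; rewrite inE; case: ifP => [_|ar]; first by rewrite eqxx.
rewrite eq_sym => /xy; have := arc_lt n_gt1 (k + 1) e; rewrite /lamp_hops => an le.
have ar' : (n <= arc (k + 1)%R e + r)%N by lia.
exists (r - (n - arc (k + 1)%R e)).+1; first by lia.
rewrite -natr1 !natrB; [|lia|lia].
rewrite Zp_natr_n // -[LHS](arcK (k + 1) e); ring.
Qed.

(** * Words read from the cuts *)

Definition letters s c x m := [seq nat_of_bool (lamp s c i \in x) | i <- iota 1 m].

Lemma size_letters s c x m : size (letters s c x m) = m.
Proof. by rewrite size_map size_iota. Qed.

Lemma lettersS s c x m :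
  letters s c x m.+1 = rcons (letters s c x m) (lamp s c m.+1 \in x).
Proof.
have E : iota 1 m.+1 = rcons (iota 1 m) m.+1 by rewrite -cats1 -[in LHS](addn1 m) iotaD.
by rewrite /letters E map_rcons.
Qed.

Lemma nth_letters s c x m p : (p < m)%N ->
  nth 0%N (letters s c x m) p = (lamp s c p.+1 \in x).
Proof. by move=> pm; rewrite (nth_map 0%N) ?size_iota // nth_iota. Qed.

Lemma letters_lt2 s c x m : all (gtn 2) (letters s c x m).
Proof. by apply/allP => _ /mapP[i _ ->] /=; case: (_ \in _). Qed.

Lemma letters_step s c u v m : step u v -> (m <= hops c u.2)%N -> (m <= hops c v.2)%N ->
  letters s c u.1 m = letters s c v.1 m.
Proof.
move=> [v2 uv]; rewrite v2 => mu mv; apply/eq_in_map => i.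
rewrite mem_iota => /andP[i0 im]; rewrite uv //; apply: lamp_off_step => //; lia.
Qed.

(* The sixteen blocks encode the pairs of one of eight cuts, [b./2], and one of
   two directions, [odd b]. *)
Definition word b u := letters (odd b) (cut n b./2) u.1 (hops (cut n b./2) u.2).

(** The depths of [u] and [v] below the cut differ by at most one, and the step changes no lamp
    within the smaller depth. *)
Lemma word_step b u v : step u v ->
  exists (t : seq nat) a, ((word b u == t) || (word b u == rcons t a)) &&
                          ((word b v == t) || (word b v == rcons t a)).
Proof.
move=> uv; have [v2 _] := uv; rewrite /word; set c := cut n _; set s := odd b.
have [] := hops_succ n_gt1 c u.2; rewrite -v2 => le1 le2.
have [lt|gt|E] := ltngtP (hops c u.2) (hops c v.2).
- have -> : hops c v.2 = (hops c u.2).+1 by lia.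
  rewrite lettersS (letters_step _ uv _ (ltnW lt)) //.
  exists (letters s c v.1 (hops c u.2)), (lamp s c (hops c u.2).+1 \in v.1).
  by rewrite !eqxx orbT.
- have -> : hops c u.2 = (hops c v.2).+1 by lia.
  rewrite lettersS (letters_step _ uv (ltnW gt)) //.
  exists (letters s c v.1 (hops c v.2)), (lamp s c (hops c v.2).+1 \in u.1).
  by rewrite !eqxx orbT.
- rewrite E (letters_step _ uv) ?E //.
  by exists (letters s c v.1 (hops c v.2)), 0%N; rewrite eqxx.
Qed.

Lemma word_size b u : size (word b u) = hops (cut n b./2) u.2.
Proof. exact: size_letters. Qed.

Lemma word_size_le b u : (size (word b u) <= n)%N.
Proof. by rewrite word_size /hops; have := arc_lt n_gt1 (cut n b./2) u.2; lia. Qed.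

Lemma words_separate_positions u v : exists2 b, (b < 16)%N &
  (8 * size (word b u) + hops u.2 v.2 <= 8 * size (word b v))%N ||
  (8 * size (word b v) + hops u.2 v.2 <= 8 * size (word b u))%N.
Proof.
(* Only the length of the word counts, so either direction would do; [i.*2] is the backward one. *)
have [i i8 H] := hops_far n_gt1 u.2 v.2; exists i.*2; first by lia.
by rewrite !word_size doubleK.
Qed.

(** Lamp [e] is the [p]-th letter of the word of [u]; in the word of [v] this letter differs or is
    missing. *)
Lemma words_separate_lamps u v e : (e \in u.1) != (e \in v.1) ->
  exists b p, [/\ (b < 16)%N, (0 < p <= size (word b u))%N,
    ~~ prefix (take p (word b u)) (word b v) &
    (lamp_hops u.2 e <= 8 * (size (word b u) - p).+1)%N].
Proof.
move=> uv; have [i [s [p [i8 pp le far]]]] := lamp_far n_gt1 u.2 e.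
set b := (s + i.*2)%N.
have b2 : b./2 = i by exact: half_bit_double.
have bs : odd b = s by rewrite oddD odd_double addbF; case: (s).
have pu : (0 < p <= size (word b u))%N by rewrite word_size b2.
exists b, p; split=> //; [by rewrite /b; case: (s); lia| |by rewrite word_size b2].
apply: contra uv; rewrite prefixE size_takel; last by case/andP: pu.
move=> /eqP E; have pv : (p <= size (word b v))%N.
  by have := congr1 size E; rewrite size_take_min size_takel;
    [move=> <-; exact: geq_minr|case/andP: pu].
have := congr1 (nth 0%N ^~ p.-1) E; rewrite /word b2 bs !nth_take; [|lia|lia].
move: pu pv; rewrite !word_size b2 => pu pv; rewrite !nth_letters; [|lia|lia].
rewrite prednK; last by lia.
by rewrite le; do 2 case: (_ \in _).
Qed.

End Lamplighter.

(** * The embedding *)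

Section Embedding.
Variables (X : BanachSpace) (N : nat) (x : nat -> X).
Variable n : nat.
Hypothesis n_gt1 : (1 < n)%N.
Hypothesis NE : N = (17 ^ n.+1)%N.
Implicit Types u v : LL n.

(** The label [b] in front gives the sixteen trees disjoint index sets. Base 17 admits labels below
    16 shifted by one; length [n.+1] admits the label and [n] letters. *)
Definition block_address b (w : seq nat) :=
  [seq code 17 n.+1 (b :: take j w) | j <- iota 1 (size w)].

Definition address u := flatten [seq block_address b (word b u) | b <- iota 0 16].

Definition embedding u := \sum_(i <- address u) x i.

Lemma block_digits b u j : (b < 16)%N -> all (fun a => a.+1 < 17)%N (b :: take j (word b u)).
Proof.
move=> b16 /=; rewrite ltnS b16 /=; apply/allP => a /mem_take.
by move=> /(allP (letters_lt2 _ _ _ _)) /=; lia.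
Qed.

Lemma block_size b u j : (size (b :: take j (word b u)) <= n.+1)%N.
Proof. by rewrite /= ltnS; have := word_size_le n_gt1 b u; rewrite size_take_min; lia. Qed.

Lemma code_ltN b u j : (b < 16)%N -> (code 17 n.+1 (b :: take j (word b u)) < N)%N.
Proof.
move=> b16; have := @code_lt 17 n.+1 _ isT (block_digits u j b16) (block_size b u j).
have : (0 < 17 ^ (n.+1 - size (b :: take j (word b u))))%N by rewrite expn_gt0.
rewrite NE; lia.
Qed.

Lemma address_ltN u : all (gtn N) (address u).
Proof.
apply/allP => i /flatten_mapP[b + /mapP[j _ ->]]; rewrite mem_iota => b16.
exact: code_ltN.
Qed.

Lemma block_address_rcons b w a :
  block_address b (rcons w a) = rcons (block_address b w) (code 17 n.+1 (b :: rcons w a)).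
Proof.
rewrite /block_address size_rcons.
have -> : iota 1 (size w).+1 = rcons (iota 1 (size w)) (size w).+1.
  by rewrite -cats1 -[in LHS](addn1 (size w)) iotaD.
rewrite map_rcons take_oversize ?size_rcons //; congr rcons.
by apply/eq_in_map => j; rewrite mem_iota -cats1 => jw; rewrite takel_cat //; lia.
Qed.

Lemma embeddingE u :
  embedding u = \sum_(b <- iota 0 16) \sum_(i <- block_address b (word b u)) x i.
Proof. by rewrite /embedding big_flatten big_map. Qed.

(** * Lipschitz bound *)

Variable K : Rstd.
Hypothesis x_le : forall i, (i < N)%N -> vnorm (x i) <= K.

(** In each of the sixteen blocks at most one vector is added or removed. *)
Lemma embedding_step u v : step u v -> vnorm (embedding u - embedding v) <= 16 * K.
Proof.
move=> uv; rewrite !embeddingE -sumrB; apply: le_trans (vnorm_sum _ _ _) _.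
have -> : 16 * K = \sum_(b <- iota 0 16) K.
  by rewrite mulr_natl; exact/esym/(sumr_const_nat 16 0 K).
have N0 : (0 < N)%N by rewrite NE expn_gt0.
have K0 : 0 <= K := le_trans (vnorm_ge0 _) (x_le N0).
rewrite big_seq [leRHS]big_seq; apply: ler_sum => b; rewrite mem_iota add0n => /andP[_ b16].
have [t [a /andP[]]] := word_step n_gt1 b uv.
have bnd (w : LL n) : word b w = rcons t a -> vnorm (x (code 17 n.+1 (b :: rcons t a))) <= K.
  move=> E; apply: x_le; have := code_ltN w (size (word b w)) b16.
  by rewrite take_size E.
move=> /orP[]/eqP Eu /orP[]/eqP Ev; have := bnd u; have := bnd v; rewrite Eu Ev
  ?block_address_rcons -?cats1 ?big_cat /= ?big_seq1.
- by rewrite subrr vnorm0.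
- by move=> H _; rewrite opprD addNKr vnormN; apply: H.
- by move=> _ H; rewrite addrAC subrr add0r; apply: H.
- by rewrite subrr vnorm0.
Qed.

Lemma embedding_reach m u v : reach m u v ->
  vnorm (embedding u - embedding v) <= 16 * K * m%:R.
Proof.
move=> [p [up <- <-]]; elim: p u up => [|w p IH] u /=.
  by rewrite subrr vnorm0 mulr0.
move=> /andP[/cay_adjP uw /IH wp];
have -> : embedding u - embedding (last w p) =
  (embedding u - embedding w) + (embedding w - embedding (last w p)) by rewrite addrA subrK.
apply: le_trans (vnormD _ _) _; rewrite -[(size p).+1]add1n natrD mulrDr mulr1; apply: lerD => //.
case: uw => [/embedding_step//|/embedding_step]; by rewrite -vnormN opprB.
Qed.

(** * Lower bound *)

Lemma count_address b P u : (b < 16)%N -> all (fun a => a.+1 < 17)%N P -> (size P <= n)%N ->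
  count (fun i => code 17 n.+1 (b :: P) <= i < code 17 n.+1 (b :: P) + 17 ^ (n - size P))%N
    (address u) = prefix_count P (word b u).
Proof.
move=> b16 dP Pn; rewrite count_flatten -map_comp sumnE big_map.
have dbP : all (fun a => a.+1 < 17)%N (b :: P) by apply/andP.
have I b' j (b'16 : (b' < 16)%N) := @code_interval 17 n.+1 (b :: P) _ isT dbP
  (block_digits u j b'16) Pn (block_size b' u j).
(* In the other blocks the words carry another label, so none extends [b :: P]. *)
rewrite (bigD1_seq b) ?iota_uniq ?mem_iota // big_seq_cond big1 => [|b'].
  apply: etrans (addn0 _) _; rewrite [LHS]count_map; apply: eq_count => j.
  by apply: etrans (I b j b16) _; rewrite /= eqxx.
rewrite mem_iota add0n => /andP[/andP[_ b'16] bb'].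
rewrite [LHS]count_map (eq_count (a2 := pred0)) ?count_pred0 // => j.
by apply: etrans (I b' j b'16) _; rewrite /= eq_sym (negbTE bb').
Qed.

Variable delta : Rstd.
Hypothesis delta_gt0 : 0 < delta.
Hypothesis x_summing : forall (c : nat -> Rstd) k,
  delta * `|\sum_(i < N | (k <= i)%N) c i| <= vnorm (\sum_(i < N) c i *: x i).

Lemma sum_count_mem (V : lmodType Rstd) (F : nat -> V) s : all (gtn N) s ->
  \sum_(i < N) (count_mem (i : nat) s)%:R *: F i = \sum_(i <- s) F i.
Proof.
elim: s => [|j s IH] /=; first by rewrite big_nil big1 // => i _; rewrite scale0r.
move=> /andP[jN sN]; rewrite big_cons -IH //.
rewrite (bigD1 (Ordinal jN)) //= [in RHS](bigD1 (Ordinal jN)) //=.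
rewrite eqxx natrD scalerDl scale1r -addrA; congr (_ + (_ + _)).
apply: eq_bigr => i; rewrite -val_eqE /= eq_sym => /negbTE->; by rewrite add0n.
Qed.

(** The difference of the two sums is a combination of the [x i] with differences of multiplicities
    as coefficients. *)
Lemma tail_count_le s t k : all (gtn N) s -> all (gtn N) t ->
  delta * `|(count (leq k) s)%:R - (count (leq k) t)%:R| <=
    vnorm (\sum_(i <- s) x i - \sum_(i <- t) x i).
Proof.
move=> sN tN; have := x_summing (fun i => (count_mem i s)%:R - (count_mem i t)%:R) k.
have E r : all (gtn N) r ->
    \sum_(i < N | (k <= i)%N) (count_mem (i : nat) r)%:R = (count (leq k) r)%:R :> Rstd.
  move=> rN; rewrite -sum1_count natr_sum [in RHS]big_mkcond /=.
  rewrite -(@sum_count_mem Rstd^o (fun i => if (k <= i)%N then 1%:R else 0)) //.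
  by rewrite big_mkcond; apply: eq_bigr => i _; case: ifP; rewrite ?scaler0 // => _;
    rewrite [RHS]mulr1.
rewrite sumrB !E // (eq_bigr (fun i : 'I_N =>
  (count_mem (i : nat) s)%:R *: x i - (count_mem (i : nat) t)%:R *: x i)) => [|i _].
  by rewrite sumrB !sum_count_mem.
by rewrite scalerBl.
Qed.

(** An interval is the difference of two tails, whence the factor 2. *)
Lemma interval_count_le s t lo hi : all (gtn N) s -> all (gtn N) t -> (lo <= hi)%N ->
  delta * `|(count (fun i => lo <= i < hi)%N s)%:R - (count (fun i => lo <= i < hi)%N t)%:R| <=
    2 * vnorm (\sum_(i <- s) x i - \sum_(i <- t) x i).
Proof.
move=> sN tN lohi.
have E r : (count (leq lo) r)%:R =
    (count (fun i => lo <= i < hi)%N r)%:R + (count (leq hi) r)%:R :> Rstd.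
  rewrite -natrD; congr _%:R; rewrite -count_predUI [X in (_ + X)%N](eq_count (a2 := pred0)).
    by rewrite count_pred0 addn0; apply: eq_count => i /=; lia.
  by move=> i /=; lia.
have := tail_count_le lo sN tN; have := tail_count_le hi sN tN.
rewrite !E; set a := (count _ s)%:R; set b := (count _ t)%:R.
set c := (count _ s)%:R; set d := (count _ t)%:R.
move: (vnorm _) => z hi_le lo_le.
have : `|c - d| <= `|(c + a) - (d + b)| + `|a - b|.
  have -> : c - d = (c + a) - (d + b) - (a - b) by ring.
  exact: ler_normB.
rewrite -(ler_pM2l delta_gt0) => /le_trans; apply; rewrite mulrDr; lra.
Qed.

Lemma prefix_count_le b P u v : (b < 16)%N -> all (fun a => a.+1 < 17)%N P -> (size P <= n)%N ->
  delta * `|(prefix_count P (word b u))%:R - (prefix_count P (word b v))%:R| <=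
    2 * vnorm (embedding u - embedding v).
Proof.
move=> b16 dP Pn; rewrite -!count_address //.
by apply: interval_count_le; rewrite ?address_ltN // leq_addr.
Qed.

Lemma embedding_hops u v : delta * (hops u.2 v.2)%:R <= 16 * vnorm (embedding u - embedding v).
Proof.
have [b b16 H] := words_separate_positions n_gt1 u v.
(* For the empty prefix the counts are the lengths of the words. *)
have := @prefix_count_le b [::] u v b16 isT isT; rewrite !prefix_count_nil.
have : (hops u.2 v.2)%:R <= 8 * `|(size (word b u))%:R - (size (word b v))%:R| :> Rstd.
  case/orP: H; rewrite -(ler_nat Rstd) natrD !natrM => H.
    by rewrite distrC; apply: le_trans (ler_wpM2l _ (ler_norm _)); lra.
  by apply: le_trans (ler_wpM2l _ (ler_norm _)); lra.
by rewrite -(ler_pM2l delta_gt0); lra.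
Qed.

(** From length [p] on, all prefixes of the word of [u] extend its first [p] letters, and none of
    the word of [v] does. The 16 is 8 from the choice of the cut times 2 from the interval. *)
Lemma embedding_lamps u v e : (e \in u.1) != (e \in v.1) ->
  delta * (lamp_hops u.2 e)%:R <= 16 * vnorm (embedding u - embedding v).
Proof.
move=> uv; have [b [p [b16 pu npre far]]] := words_separate_lamps n_gt1 uv.
have [] := andP (block_digits u p b16) => _ dP.
have sP : (size (take p (word b u)) <= n)%N := block_size b u p.
have := prefix_count_le u v b16 dP sP.
rewrite prefix_count_take // (prefix_count_eq0 npre) subr0 ger0_norm ?ler0n //.
by move: far; rewrite -(ler_nat Rstd) natrM -(ler_pM2l delta_gt0); lra.
Qed.

(** In the length [4 * r + hops] of the walk, each of the five terms is at most [16 / delta] times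
    the norm, whence 80. *)
Lemma embedding_lower u v d : cay_dist u v d ->
  delta / 80 * d%:R <= vnorm (embedding u - embedding v).
Proof.
move=> [_ dmin]; pose D := [set e | (e \in u.1) != (e \in v.1)].
pose r := \max_(e in D) lamp_hops u.2 e.
have d_le : (d <= 4 * r + hops u.2 v.2)%N.
  have [|p [up lp <-]] := @reach_le n n_gt1 u.1 v.1 u.2 v.2 r.
    by move=> e ne; apply: leq_bigmax_cond; rewrite inE.
  by apply: dmin; move: up lp; rewrite -!surjective_pairing.
have r_le : delta * r%:R <= 16 * vnorm (embedding u - embedding v).
  have [D0|[e eD]] := set_0Vmem D.
    by rewrite /r D0 big_set0 mulr0 mulr_ge0 ?vnorm_ge0.
  have [|e' e'D rE] := @eq_bigmax_cond _ (mem D) (lamp_hops u.2).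
    by apply/card_gt0P; exists e.
  rewrite (_ : r = lamp_hops u.2 e') //.
  by apply: embedding_lamps; have : e' \in D := e'D; rewrite inE.
have := embedding_hops u v.
move: d_le; rewrite -(ler_nat Rstd) natrD natrM -(ler_pM2l delta_gt0).
by rewrite mulrAC ler_pdivrMr //; lra.
Qed.

End Embedding.

Theorem theorem1p3 (X : BanachSpace) (hX : ~ superreflexive X) :
  exists C : R, forall n : nat, (2 <= n)%N ->
    exists (f : LL n -> X) (s : R), Rlt R0 s /\
      forall (u v : LL n) (d : nat), cay_dist u v d ->
        Rle (Rmult s (INR d)) (vdist (f u) (f v)) /\
        Rle (vdist (f u) (f v)) (Rmult (Rmult C s) (INR d)).
Proof.
have [delta [K [d0 H]]] := summing_sequences hX.
(* The ratio of the Lipschitz constant [16 * K] to the lower constant [delta / 80]; [delta] and [K]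
   are independent of the length [17 ^ n.+1] of the sequence. *)
exists (16 * K * (80 / delta))%R => n n_gt1; have [x [xK xs]] := H (17 ^ n.+1)%N.
exists (@embedding X x n), (delta / 80)%R; split; first by apply/RltP; rewrite divr_gt0.
move=> u v d uvd; split; apply/RleP; rewrite INRE.
  exact: (embedding_lower n_gt1 erefl d0 xs uvd).
have [[p [up lp sp]] _] := uvd.
have E : 16 * K * (80 / delta) * (delta / 80) = 16 * K by field; lra.
have uv : reach d u v by exists p.
by have H' := embedding_reach n_gt1 erefl xK uv; rewrite -E in H'.
Qed.
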